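(* Let $z_*=x_*+iy_*\in\mathbb{C}$ with $x_*,y_*\in\mathbb{R}$ and let $R>0$. (1) If $0\notin \overline{B}(z_*,R)$, then $$\iota(B(z_*,R)) = B\left(\frac{-x_*}{R^2-(x_*^2+y_*^2)}+i\frac{y_*}{R^2-(x_*^2+y_*^2)},\ \frac{R}{|R^2-(x_*^2+y_*^2)|}\right).$$ (2) If $0\in B(z_*,R)$, then $$\iota(B(z_*,R)) = \overline{\mathbb{C}}\setminus \overline{B}\left(\frac{-x_*}{R^2-(x_*^2+y_*^2)}+i\frac{y_*}{R^2-(x_*^2+y_*^2)},\ \frac{R}{R^2-(x_*^2+y_*^2)}\right).$$
   Context: $\overline{\mathbb{C}}=\mathbb{C}\cup\{\infty\}$ is the Riemann sphere and $\iota:\overline{\mathbb{C}}\to\overline{\mathbb{C}}$ is the inversion $\iota(z)=z^{-1}$ with $\iota(0)=\infty$ and $\iota(\infty)=0$. $B(w,r)=\{z\in\mathbb{C}:|z-w|<r\}$ and $\overline{B}(w,r)=\{z\in\mathbb{C}:|z-w|\le r\}$ denote the open and closed balls in $\mathbb{C}$ centered at $w$ with radius $r>0$. *)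

(* Defs.v *)
From mathcomp Require Export all_boot all_order all_algebra.
From mathcomp Require Export all_classical all_reals all_analysis.
From mathcomp Require Export complex.
Export numFieldNormedType.Exports.

Set Implicit Arguments.
Unset Strict Implicit.
Unset Printing Implicit Defensive.

Local Open Scope classical_set_scope.
Local Open Scope ring_scope.
Local Open Scope complex_scope.

Definition riemann_sphere (R : realType) : Type :=
  one_point_compactification R[i].

Definition sphere_infty (R : realType) : riemann_sphere R := None.

Definition sphere_of_complex (R : realType) (z : R[i]) : riemann_sphere R :=
  Some z.

(* The guard is needed because 0^-1 = 0 in R[i]. *)
Definition inversion (R : realType) (z : riemann_sphere R) : riemann_sphere R :=
  match z with
  | Some w => if w == 0 then sphere_infty R else sphere_of_complex w^-1
  | None => sphere_of_complex 0
  end.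

(* The norm of R[i] takes values in R[i] (with the partial order of R[i]), so the
   real radius is embedded with %:C. *)
Definition open_disk (R : realType) (w : R[i]) (r : R) : set R[i] :=
  ball (w : R[i]^o) r%:C.

Definition closed_disk (R : realType) (w : R[i]) (r : R) : set R[i] :=
  closed_ball_ (@Num.norm _ R[i]) w r%:C.

(* Main.v *)
(* The map is an involution, so images are preimages. For w <> 0 the identity
     |z - 1/w|^2 - r^2 = - (|c - w|^2 - (r/d)^2) d / |w|^2
   shows that w^-1 lies in the disk around z exactly when w lies inside (d < 0)
   or outside (d > 0) the disk around c; the points 0 and infinity are checked
   separately. *)
Require Import Defs.
From mathcomp Require Import ring.
Import Order.TTheory GRing.Theory Num.Theory.

Local Open Scope classical_set_scope.
Local Open Scope ring_scope.
Local Open Scope complex_scope.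

Lemma inversionK (R : realType) : involutive (@inversion R).
Proof.
case=> [w|] /=; last by rewrite eqxx.
by case: eqVneq => [->|w0] //=; rewrite invr_eq0 (negbTE w0) invrK.
Qed.

Lemma image_inversion (R : realType) (A : set (riemann_sphere R)) :
  @inversion R @` A = @inversion R @^-1` A.
Proof.
apply/seteqP; split=> p /=; first by case=> q Aq <-; rewrite inversionK.
by move=> Ap; exists (inversion p) => //; rewrite inversionK.
Qed.

Lemma preimage_inversion (R : realType) (A : set (riemann_sphere R)) (w : R[i]) :
  (@inversion R @^-1` A) (Some w) = A (if w == 0 then None else Some w^-1).
Proof. by []. Qed.

Lemma preimage_inversion_infty (R : realType) (A : set (riemann_sphere R)) :
  (@inversion R @^-1` A) None = A (Some 0).
Proof. by []. Qed.

Lemma image_sphere_of_complex (R : realType) (A : set R[i]) (w : R[i]) :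
  (@sphere_of_complex R @` A) (Some w) = A w.
Proof.
by apply/propext; split=> [[v Av [<-]]|Aw]; last by exists w.
Qed.

Lemma image_sphere_of_complex_infty (R : realType) (A : set R[i]) :
  ~ (@sphere_of_complex R @` A) None.
Proof. by case. Qed.

(** The modulus is the square root of the sum of squares and [r] is the square root of [r ^+ 2], so
    monotonicity of the square root removes both roots. *)
Lemma open_diskE (R : realType) (a b u v r : R) : 0 < r ->
  open_disk (a +i* b) r (u +i* v) = ((a - u) ^+ 2 + (b - v) ^+ 2 < r ^+ 2).
Proof.
move=> r0; rewrite /open_disk -ball_normE /ball_ /= normc_def /= ltcR.
by rewrite -{1}(gtr0_norm r0) -sqrtr_sqr ltr_sqrt // exprn_gt0.
Qed.

Lemma closed_diskE (R : realType) (a b u v r : R) : 0 <= r ->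
  closed_disk (a +i* b) r (u +i* v) = ((a - u) ^+ 2 + (b - v) ^+ 2 <= r ^+ 2).
Proof.
move=> r0; rewrite /closed_disk /closed_ball_ /= normc_def /= lecR.
by rewrite -{1}(ger0_norm r0) -sqrtr_sqr ler_sqrt // sqr_ge0.
Qed.

(** For [w = u +i* v] the inverse is u/n - i v/n, hence the plus sign in the second square. On
    expanding, both sides become (1 - 2(xu - yv) - d n)/n. *)
Lemma sqr_dist_inv (R : realType) (x y u v r : R) :
  let d := r ^+ 2 - (x ^+ 2 + y ^+ 2) in
  let n := u ^+ 2 + v ^+ 2 in
  d != 0 -> n != 0 ->
  (x - u / n) ^+ 2 + (y + v / n) ^+ 2 - r ^+ 2 =
  - (((- x / d - u) ^+ 2 + (y / d - v) ^+ 2 - (r / d) ^+ 2) * (d / n)).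
Proof. by move=> d n d0 n0; rewrite /d /n in d0 n0 *; field; rewrite d0 n0. Qed.

Theorem theorem4 (R : realType) (x y r : R) (hr : 0 < r) :
  let z := x +i* y in
  let d := r ^+ 2 - (x ^+ 2 + y ^+ 2) in
  let c := (- x / d) +i* (y / d) in
  (~ closed_disk z r 0 ->
   (@inversion R) @` (@sphere_of_complex R @` open_disk z r) =
   @sphere_of_complex R @` open_disk c (r / `|d|)) /\
  (open_disk z r 0 ->
   (@inversion R) @` (@sphere_of_complex R @` open_disk z r) =
   [set: riemann_sphere R] `\` (@sphere_of_complex R @` closed_disk c (r / d))).
Proof.
move=> z d c; rewrite image_inversion.
have r0 := ltW hr.
(* For [w = 0]: since |c|^2 = |z|^2/d^2, comparing |c| with r/|d| amounts to comparing |z| with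
   [r]. *)
have sqr_c : (- x / d - 0) ^+ 2 + (y / d - 0) ^+ 2 = (x ^+ 2 + y ^+ 2) / d ^+ 2.
  by rewrite !subr0 !expr_div_n sqrrN mulrDl.
have n_gt0 u v : (u +i* v == 0 :> R[i]) = false -> 0 < u ^+ 2 + v ^+ 2.
  rewrite eq_complex /= => /negbT uv0.
  rewrite lt_neqAle addr_ge0 ?sqr_ge0 // eq_sym paddr_eq0 ?sqr_ge0 //.
  by rewrite !sqrf_eq0 uv0.
split.
- rewrite closed_diskE // !subr0 => /negP; rewrite -ltNge => rN.
  have d0 : d < 0 by rewrite /d subr_lt0.
  have rd : 0 < r / `|d| by rewrite divr_gt0 ?normr_gt0 ?ltr0_neq0.
  have rdE : (r / `|d|) ^+ 2 = (r / d) ^+ 2.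
    by rewrite !expr_div_n real_normK // num_real.
  apply/funext => -[[u v]|].
    rewrite preimage_inversion image_sphere_of_complex.
    case: ifPn => [/eqP [-> ->]|/negbTE uv0].
      (* Here [w = 0], and both sides are false: infinity is not in the image of a disk, and |z| > r
         keeps 0 out of the disk around [c]. *)
      rewrite open_diskE // rdE sqr_c expr_div_n.
      rewrite ltr_pM2r ?invr_gt0 ?exprn_even_gt0 ?ltr0_neq0 //.
      apply/propext; split=> [/image_sphere_of_complex_infty//|].
      by rewrite ltNge (ltW rN).
    have n0 := n_gt0 _ _ uv0.
    rewrite image_sphere_of_complex open_diskE // open_diskE // rdE.
    rewrite opprK -subr_lt0 sqr_dist_inv ?(ltr0_neq0 d0) ?gt_eqF //.
    (* The factor -(d/n) is positive because [d < 0], so the two differences have the same sign. *)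
    by rewrite -mulrN pmulr_llt0 ?subr_lt0 // -mulNr divr_gt0 ?oppr_gt0.
  rewrite preimage_inversion_infty image_sphere_of_complex.
  rewrite open_diskE // !subr0 ltNge (ltW rN).
  by apply/propext; split=> // /image_sphere_of_complex_infty.
- rewrite open_diskE // !subr0 => Nr.
  have d0 : 0 < d by rewrite /d subr_gt0.
  have rd : 0 <= r / d by rewrite divr_ge0 // ltW.
  rewrite setTD; apply/funext => -[[u v]|].
    rewrite preimage_inversion [RHS]/setC /mkset image_sphere_of_complex.
    case: ifPn => [/eqP [-> ->]|/negbTE uv0].
      (* Again both sides are false at [w = 0]: now |z| < r puts 0 in the closed disk around [c],
         hence outside its complement. *)
      rewrite closed_diskE // sqr_c expr_div_n ler_pM2r ?invr_gt0 ?exprn_gt0 //.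
      apply/propext; split=> [/image_sphere_of_complex_infty//|].
      by rewrite (ltW Nr).
    have n0 := n_gt0 _ _ uv0.
    rewrite image_sphere_of_complex open_diskE // closed_diskE //.
    rewrite opprK -subr_lt0 sqr_dist_inv ?gt_eqF // oppr_lt0.
    (* Now d/n is positive and the minus sign remains: the inside of one disk corresponds to the
       strict outside of the other, so the removed disk is closed. *)
    rewrite pmulr_lgt0 ?divr_gt0 // subr_gt0 ltNge.
    by apply/propext; split=> /negP.
  (* At infinity both sides hold: its inverse 0 lies in the disk around [z], and no closed disk
     contains infinity. *)
  rewrite preimage_inversion_infty image_sphere_of_complex.
  rewrite open_diskE // !subr0 Nr.
  by apply/propext; split=> // _ /image_sphere_of_complex_infty.
Qed.
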